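(* A topological space is quasi-Polish if and only if it is a $T_0$ convergent approximation space having a countable basis.
   Context: Quasi-Polish: a topological space with a countable basis whose topology is induced by a complete quasi-metric, where a quasi-metric on $E$ is $d:E^2\to[0,+\infty)$ with $x=y\iff d(x,y)=d(y,x)=0$ and $d(x,z)\le d(x,y)+d(y,z)$ (topology generated by open balls $\{y:d(x,y)<r\}$), and completeness means every sequence with $\lim_n\sup_{p\ge n}d(x_n,x_p)=0$ converges for the metric $\max(d(x,y),d(y,x))$. Convergent approximation relation: a binary relation $\ll$ on a topological basis $\mathcal{B}$ such that for all $U,V,T\in\mathcal{B}$: (1) $U\ll V\Rightarrow V\subseteq U$; (2) $U\subseteq T$ and $U\ll V$ imply $T\ll V$; (3) for every $x\in U$ there is $W\in\mathcal{B}$ with $x\in W$, $U\ll W$; (4$^+$) every sequence $(U_i)$ in $\mathcal{B}$ with $U_i\ll U_{i+1}$ for all $i$ is a neighborhood basis of some point $x\in\bigcap_i U_i$. A convergent approximation space is a space admitting such a relation. *)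

(* Defs.v *)
From Stdlib Require Import Reals.
Open Scope R_scope.

Record topology (X : Type) := Topology {
  is_open : (X -> Prop) -> Prop;
  open_full : is_open (fun _ => True);
  open_inter : forall U V, is_open U -> is_open V -> is_open (fun x => U x /\ V x);
  open_union : forall F : (X -> Prop) -> Prop,
      (forall U, F U -> is_open U) -> is_open (fun x => exists U, F U /\ U x)
}.
Arguments is_open {X} t U.

Definition is_basis {X : Type} (t : topology X) (B : (X -> Prop) -> Prop) : Prop :=
  (forall U, B U -> is_open t U) /\
  (forall U, is_open t U -> forall x, U x ->
     exists W, B W /\ W x /\ (forall y, W y -> U y)).

Definition has_countable_basis {X : Type} (t : topology X) : Prop :=
  exists b : nat -> (X -> Prop), is_basis t (fun W => exists n, W = b n).

Definition T0 {X : Type} (t : topology X) : Prop :=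
  forall x y : X, (forall U, is_open t U -> (U x <-> U y)) -> x = y.

Definition quasi_metric {X : Type} (d : X -> X -> R) : Prop :=
  (forall x y, 0 <= d x y) /\
  (forall x y, x = y <-> (d x y = 0 /\ d y x = 0)) /\
  (forall x y z, d x z <= d x y + d y z).

Definition qm_open {X : Type} (d : X -> X -> R) (U : X -> Prop) : Prop :=
  forall x, U x -> exists r, 0 < r /\ forall y, d x y < r -> U y.

Definition induces {X : Type} (d : X -> X -> R) (t : topology X) : Prop :=
  forall U, is_open t U <-> qm_open d U.

Definition qm_cauchy {X : Type} (d : X -> X -> R) (x : nat -> X) : Prop :=
  forall eps, 0 < eps -> exists N, forall n p, (N <= n)%nat -> (n <= p)%nat ->
    d (x n) (x p) <= eps.

Definition sym_converges {X : Type} (d : X -> X -> R) (x : nat -> X) (l : X) : Prop :=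
  forall eps, 0 < eps -> exists N, forall n, (N <= n)%nat ->
    Rmax (d (x n) l) (d l (x n)) < eps.

Definition qm_complete {X : Type} (d : X -> X -> R) : Prop :=
  forall x : nat -> X, qm_cauchy d x -> exists l, sym_converges d x l.

Definition quasi_polish {X : Type} (t : topology X) : Prop :=
  has_countable_basis t /\
  exists d : X -> X -> R, quasi_metric d /\ induces d t /\ qm_complete d.

Definition conv_approx_relation {X : Type} (t : topology X)
    (B : (X -> Prop) -> Prop) (ll : (X -> Prop) -> (X -> Prop) -> Prop) : Prop :=
  is_basis t B /\
  (forall U V, B U -> B V -> ll U V -> forall x, V x -> U x) /\
  (forall U V T, B U -> B V -> B T ->
     (forall x, U x -> T x) -> ll U V -> ll T V) /\
  (forall U, B U -> forall x, U x -> exists W, B W /\ W x /\ ll U W) /\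
  (forall Us : nat -> (X -> Prop),
     (forall i, B (Us i)) -> (forall i, ll (Us i) (Us (S i))) ->
     exists x, (forall i, Us i x) /\
       (forall W, is_open t W -> W x -> exists i, forall y, Us i y -> W y)).

Definition conv_approx_space {X : Type} (t : topology X) : Prop :=
  exists B ll, conv_approx_relation t B ll.

(* Main.v *)
(** A quasi-Polish space with basis [b n] and quasi-metric [d] gets its relation
    by letting [T << V] when [V] lies well inside a ball contained in some
    [b n] included in [T], of radius at most [1/(n+1)].  Along a chain these
    [b n] decrease, so either their indices tend to infinity and the centres of
    the balls are Cauchy, or the chain is eventually constant; constancy is
    only allowed on minimal neighbourhoods of points.

    Conversely, a point of a second-countable convergent approximation space is
    determined by the indices of its basic neighbourhoods, and the sets of indices
    so obtained are described by countably many conditions of the form "if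
    [n] and [m] belong to it, so does some [k] that both approximate".  The
    distance from [x] to [y] is [1/(j+1)] for the first condition [j] whose least
    witness increases from [x] to [y]; along a Cauchy sequence the
    witnesses then stay bounded, so the limiting set of indices satisfies all the
    conditions, hence comes from a point. *)

Require Import Defs.
From Stdlib Require Import Reals Lra Lia Arith Cantor Classical.
From Stdlib Require Import FunctionalExtensionality PropExtensionality.
From Stdlib Require Import IndefiniteDescription.

(** * Preliminaries on reciprocals, least witnesses and quasi-metric topologies *)

Lemma inv_INR_S_pos (n : nat) : 0 < / INR (S n).
Proof. apply Rinv_0_lt_compat, lt_0_INR; lia. Qed.

Lemma inv_INR_S_le (m n : nat) : (m <= n)%nat -> / INR (S n) <= / INR (S m).
Proof.
intros H; apply Rinv_le_contravar.
- apply lt_0_INR; lia.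
- apply le_INR; lia.
Qed.

Lemma inv_INR_S_small (eps : R) : 0 < eps -> exists n, / INR (S n) < eps.
Proof.
intros H; destruct (archimed_cor1 eps H) as [[|n] [Hn Hpos]]; [lia|].
now exists n.
Qed.

Lemma least_witness (P : nat -> Prop) :
  (exists n, P n) -> exists n, P n /\ forall m, P m -> (n <= m)%nat.
Proof.
intros [n Hn]; revert Hn.
induction n as [n IH] using lt_wf_ind; intros Hn.
destruct (classic (exists m, (m < n)%nat /\ P m)) as [[m [Hm HP]]|H].
- exact (IH m Hm HP).
- exists n; split; [exact Hn|]; intros m Hm.
  destruct (Nat.le_gt_cases n m) as [|Hlt]; [assumption|].
  exfalso; eauto.
Qed.

Lemma open_of_nbhds {X : Type} (t : topology X) (U : X -> Prop) :
  (forall x, U x -> exists V, is_open t V /\ V x /\ forall y, V y -> U y) ->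
  is_open t U.
Proof.
intros H.
replace U with
  (fun x => exists V, (is_open t V /\ forall y, V y -> U y) /\ V x).
- apply open_union; tauto.
- apply functional_extensionality; intros x; apply propositional_extensionality.
  split; [intros [V [[_ HV] Hx]]; auto|].
  intros Hx; destruct (H x Hx) as [V [HV [Vx VU]]]; exists V; tauto.
Qed.

Lemma qm_refl {X : Type} (d : X -> X -> R) (x : X) :
  quasi_metric d -> d x x = 0.
Proof. intros [_ [Hsep _]]; now apply Hsep. Qed.

Lemma open_ball {X : Type} (t : topology X) (d : X -> X -> R) (x : X) (r : R) :
  quasi_metric d -> induces d t -> is_open t (fun y => d x y < r).
Proof.
intros [_ [_ Htri]] Hind; apply Hind; intros y Hy.
exists (r - d x y); split; [lra|]; intros z Hz.
specialize (Htri x y z); lra.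
Qed.

Lemma quasi_metric_T0 {X : Type} (t : topology X) (d : X -> X -> R) :
  quasi_metric d -> induces d t -> T0 t.
Proof.
intros Hd Hind x y Hxy.
assert (H : forall u v, (forall U, is_open t U -> U u -> U v) -> d u v = 0).
{ intros u v Huv; destruct (Rle_lt_or_eq_dec 0 (d u v)) as [Hpos|]; auto; [apply Hd|].
  exfalso; apply (Rlt_irrefl (d u v)).
  apply (Huv (fun z => d u z < d u v)).
  - now apply open_ball.
  - now rewrite qm_refl. }
apply Hd; split; apply H; intros U HU; now apply (Hxy U HU).
Qed.

(** * From a complete quasi-metric to a convergent approximation relation *)

Definition minimal_nbhd {X : Type} (t : topology X) (x : X) (V : X -> Prop) : Prop :=
  V x /\ forall W, is_open t W -> W x -> forall y, V y -> W y.

(** The gap between [s] and [r] keeps limits of points of [V] inside [U]: a point within [r - s] of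
    [V] is still in the ball of radius [r]. *)
Definition ball_step {X : Type} (t : topology X) (d : X -> X -> R)
    (U : X -> Prop) (n : nat) (y : X) (V : X -> Prop) : Prop :=
  (exists s r, 0 < s < r /\ r <= / INR (S n) /\
     (forall z, d y z < r -> U z) /\ (forall z, V z -> d y z < s)) /\
  ((forall z, U z -> V z) -> exists x, minimal_nbhd t x V).

Definition ball_approx {X : Type} (t : topology X) (d : X -> X -> R)
    (b : nat -> X -> Prop) (T V : X -> Prop) : Prop :=
  exists n y, (forall z, b n z -> T z) /\ ball_step t d (b n) n y V.

Lemma ball_step_sub {X : Type} (t : topology X) (d : X -> X -> R) U n y V :
  ball_step t d U n y V -> forall z, V z -> U z.
Proof.
intros [[s [r [Hsr [_ [HU HV]]]]] _] z Hz; apply HU.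
specialize (HV z Hz); lra.
Qed.

(** Either some basic neighbourhood of [x] inside the half-radius ball fails to contain [b n], and
    it serves as [b m]; or all of them contain [b n], and then any of them is a minimal
    neighbourhood of [x]. *)
Lemma ball_approx_refines {X : Type} (t : topology X) (d : X -> X -> R)
    (b : nat -> X -> Prop) n x :
  quasi_metric d -> induces d t -> is_basis t (fun W => exists n, W = b n) ->
  b n x -> exists m, b m x /\ ball_approx t d b (b n) (b m).
Proof.
intros Hd Hind [Hop Hbas] Hx.
assert (Hn : is_open t (b n)) by (apply Hop; eauto).
destruct (proj1 (Hind _) Hn x Hx) as [r0 [Hr0 Hball0]].
set (r := Rmin r0 (/ INR (S n))).
assert (Hr : 0 < r) by (apply Rmin_pos; [assumption|apply inv_INR_S_pos]).
assert (Hball : forall z, d x z < r -> b n z).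
{ intros z Hz; apply Hball0; eapply Rlt_le_trans; [exact Hz|apply Rmin_l]. }
assert (Hopen : is_open t (fun z => d x z < r / 2)) by now apply open_ball.
assert (Hin : d x x < r / 2) by (rewrite qm_refl by assumption; lra).
assert (Hstep : forall m, (forall z, b m z -> d x z < r / 2) ->
   ((forall z, b n z -> b m z) -> exists c, minimal_nbhd t c (b m)) ->
   ball_approx t d b (b n) (b m)).
{ intros m Hm Hmin; exists n, x; split; [auto|]; split; [|exact Hmin].
  exists (r / 2), r; repeat split; auto; [lra|lra|apply Rmin_r]. }
destruct (classic (exists m, b m x /\ (forall z, b m z -> d x z < r / 2) /\
                     ~ (forall z, b n z -> b m z)))
  as [[m [Hmx [Hm Hneq]]]|Hall].
- exists m; split; [exact Hmx|]; apply Hstep; tauto.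
- destruct (Hbas _ Hopen x Hin) as [W [[m ->] [Hmx Hm]]].
  exists m; split; [exact Hmx|]; apply Hstep; [exact Hm|].
  intros Hnm; exists x; split; [exact Hmx|]; intros W HW Wx y Hy.
  destruct (Hbas _ (open_inter X t _ _ HW Hopen) x (conj Wx Hin))
    as [W' [[k ->] [Hkx Hk]]].
  apply (Hk y); apply NNPP; intros Hky; apply Hall; exists k.
  split; [exact Hkx|]; split; [intros z Hz; now apply Hk|].
  intros Hnk; apply Hky, Hnk, Hball; specialize (Hm y Hy); simpl in Hm; lra.
Qed.

Lemma decreasing_le {X : Type} (V : nat -> X -> Prop) :
  (forall i z, V (S i) z -> V i z) ->
  forall i j, (i <= j)%nat -> forall z, V j z -> V i z.
Proof. intros H i j Hij; induction Hij; auto. Qed.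

(** Each index is taken only finitely often: returning to [k] after a strict decrease would make the
    decreasing sets equal in between. *)
Lemma indices_unbounded {X : Type} (b : nat -> X -> Prop) (N : nat -> nat) :
  (forall i j, (i <= j)%nat -> forall z, b (N j) z -> b (N i) z) ->
  (forall m, exists i, (m <= i)%nat /\ ~ (forall z, b (N i) z -> b (N (S i)) z)) ->
  forall k, exists m, forall i, (m <= i)%nat -> (k <= N i)%nat.
Proof.
intros Hdec Hstrict k; induction k as [|k [m Hm]]; [exists 0%nat; lia|].
destruct (classic (exists i, (m <= i)%nat /\ N i = k)) as [[i [Hi Hk]]|H].
- destruct (Hstrict i) as [p [Hp Hne]].
  exists (S p); intros j Hj.
  assert (N j <> k).
  { intros Hjk; apply Hne; intros z Hz.
    apply (Hdec _ _ Hj); rewrite Hjk, <- Hk; now apply (Hdec i p). }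
  specialize (Hm j ltac:(lia)); lia.
- exists m; intros i Hi.
  assert (N i <> k) by (intros E; apply H; eauto).
  specialize (Hm i Hi); lia.
Qed.

Lemma ball_approx_chain {X : Type} (t : topology X) (d : X -> X -> R)
    (b : nat -> X -> Prop) (V : nat -> X -> Prop) :
  quasi_metric d -> induces d t -> qm_complete d ->
  (forall i, ball_approx t d b (V i) (V (S i))) ->
  exists x, (forall i, V i x) /\
    (forall W, is_open t W -> W x -> exists i, forall y, V i y -> W y).
Proof.
intros Hd Hind Hcomp Hchain.
destruct (functional_choice _ Hchain) as [N HN].
destruct (functional_choice _ HN) as [c Hc]; clear HN Hchain.
assert (HbV : forall i z, b (N i) z -> V i z) by (intros i; apply Hc).
assert (HVb : forall i z, V (S i) z -> b (N i) z).
{ intros i; eapply ball_step_sub; apply Hc. }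
assert (HV : forall i j, (i <= j)%nat -> forall z, V j z -> V i z).
{ apply decreasing_le; auto. }
assert (Hb : forall i j, (i <= j)%nat -> forall z, b (N j) z -> b (N i) z).
{ apply (decreasing_le (fun i => b (N i))); auto. }
destruct (classic (exists m, forall i, (m <= i)%nat ->
                      forall z, b (N i) z -> b (N (S i)) z))
  as [[m Hm]|Hstrict].
- assert (Hconst : forall i, (m <= i)%nat -> forall z, b (N m) z -> b (N i) z).
  { intros i Hi; induction Hi; auto. }
  (* Here [b (N m)], [V (S m)] and [b (N (S m))] coincide, so the second clause of [ball_step]
     supplies the limit point. *)
  destruct (Hc m) as [_ [_ Hmin]].
  destruct Hmin as [x [Hx HW]]; [intros z Hz; apply HbV; auto|].
  exists x; split; [|intros W HWo Wx; exists (S m); exact (HW W HWo Wx)].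
  intros i; apply (HV i (S (m + i))); [lia|].
  apply HbV, Hconst, HVb; [lia|exact Hx].
- assert (Hidx : forall k, exists m, forall i, (m <= i)%nat -> (k <= N i)%nat).
  { apply (indices_unbounded b N Hb).
    intros m; apply NNPP; intros H; apply Hstrict; exists m; intros i Hi.
    apply NNPP; intros Hne; apply H; eauto. }
  assert (Hrad : forall i, exists s r, 0 < s < r /\ r <= / INR (S (N i)) /\
     (forall z, d (c i) z < r -> V i z) /\ (forall z, V (S i) z -> d (c i) z < s)).
  { intros i; destruct (Hc i) as [_ [[s [r [H1 [H2 [H3 H4]]]]] _]].
    exists s, r; repeat split; auto; lra. }
  assert (Hcin : forall i, V i (c i)).
  { intros i; destruct (Hrad i) as [s [r [Hsr [_ [HU _]]]]].
    apply HU; rewrite qm_refl by assumption; lra. }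
  assert (Hsmall : forall eps, 0 < eps -> exists m, forall i, (m <= i)%nat ->
            forall z, V (S i) z -> d (c i) z < eps).
  { intros eps Heps; destruct (inv_INR_S_small eps Heps) as [k Hk].
    destruct (Hidx k) as [m Hm]; exists m; intros i Hi z Hz.
    destruct (Hrad i) as [s [r [Hsr [Hr [_ HVs]]]]].
    specialize (HVs z Hz).
    assert (H := inv_INR_S_le k (N i) (Hm i Hi)); lra. }
  destruct (Hcomp c) as [x Hx].
  { intros eps Heps; destruct (Hsmall eps Heps) as [m Hm].
    exists m; intros n p Hn Hp.
    destruct (Nat.eq_dec n p) as [->|Hne]; [rewrite qm_refl by assumption; lra|].
    left; apply Hm; [exact Hn|]; apply (HV (S n) p); [lia|auto]. }
  assert (Hlim : forall eps, 0 < eps -> exists m, forall i, (m <= i)%nat ->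
            d (c i) x < eps /\ d x (c i) < eps).
  { intros eps Heps; destruct (Hx eps Heps) as [m Hm]; exists m; intros i Hi.
    specialize (Hm i Hi); split; eapply Rle_lt_trans; try exact Hm;
      [apply Rmax_l|apply Rmax_r]. }
  destruct Hd as [_ [_ Htri]].
  exists x; split.
  + intros i; destruct (Hrad i) as [s [r [Hsr [_ [HU HVs]]]]]; apply HU.
    (* Late centres are within [s] of [c i], so their limit is within [r]. *)
    destruct (Hlim (r - s) ltac:(lra)) as [m Hm].
    destruct (Hm (S (i + m)) ltac:(lia)) as [H1 _].
    assert (H2 : d (c i) (c (S (i + m))) < s).
    { apply HVs, (HV (S i) (S (i + m))); [lia|auto]. }
    specialize (Htri (c i) (c (S (i + m))) x); lra.
  + intros W HW Wx; destruct (proj1 (Hind W) HW x Wx) as [r [Hr HWr]].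
    destruct (Hlim (r / 2) ltac:(lra)) as [m1 Hm1].
    destruct (Hsmall (r / 2) ltac:(lra)) as [m2 Hm2].
    exists (S (m1 + m2)); intros y Hy; apply HWr.
    (* The distance from the limit to the centre is the half of symmetric convergence used here. *)
    destruct (Hm1 (m1 + m2)%nat ltac:(lia)) as [_ H1].
    specialize (Hm2 (m1 + m2)%nat ltac:(lia) y Hy).
    specialize (Htri x (c (m1 + m2)%nat) y); lra.
Qed.

Lemma quasi_polish_conv_approx {X : Type} (t : topology X) :
  quasi_polish t -> conv_approx_space t.
Proof.
intros [[b Hb] [d [Hd [Hind Hcomp]]]].
exists (fun W => exists n, W = b n), (ball_approx t d b).
split; [exact Hb|]; split; [|split; [|split]].
- intros U V _ _ [n [y [HU Hstep]]] x Hx.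
  apply HU; eapply ball_step_sub; eauto.
- intros U V T _ _ _ HUT [n [y [HU Hstep]]]; exists n, y; auto.
- intros U [n ->] x Hx.
  destruct (ball_approx_refines t d b n x Hd Hind Hb Hx) as [m Hm].
  exists (b m); split; [eauto|exact Hm].
- intros Us _ Hchain; now apply (ball_approx_chain t d b).
Qed.

(** * From a countable approximation to a complete quasi-metric *)

(** Take [/ INR (S n)] for the first preorder [n] that fails, and [0] if none does. By transitivity
    a failure from [x] to [z] already occurs from [x] to [y] or from [y] to [z], whence the triangle
    inequality. *)
Lemma preorders_quasi_metric {X : Type} (good : nat -> X -> X -> Prop) :
  (forall j x, good j x x) ->
  (forall j x y z, good j x y -> good j y z -> good j x z) ->
  exists d : X -> X -> R,
    (forall x y, 0 <= d x y) /\
    (forall x y z, d x z <= d x y + d y z) /\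
    (forall x y, d x y = 0 <-> forall j, good j x y) /\
    (forall n x y, d x y < / INR (S n) <-> forall j, (j <= n)%nat -> good j x y).
Proof.
intros Hrefl Htrans.
pose (spec := fun (p : X * X) (r : R) =>
  (r = 0 /\ forall j, good j (fst p) (snd p)) \/
  (exists n, r = / INR (S n) /\ ~ good n (fst p) (snd p) /\
             forall j, (j < n)%nat -> good j (fst p) (snd p))).
assert (Hex : forall p, exists r, spec p r).
{ intros p; destruct (classic (forall j, good j (fst p) (snd p))) as [H|H].
  - exists 0; left; auto.
  - apply not_all_ex_not in H; apply least_witness in H.
    destruct H as [n [Hn Hmin]]; exists (/ INR (S n)); right; exists n.
    repeat split; auto; intros j Hj; apply NNPP; intros Hbad.
    specialize (Hmin j Hbad); lia. }
destruct (functional_choice _ Hex) as [f Hf]; clear Hex.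
pose (d := fun x y => f (x, y)).
assert (Hd : forall x y, spec (x, y) (d x y)) by (intros; apply Hf).
assert (Hpos : forall x y, 0 <= d x y).
{ intros x y; destruct (Hd x y) as [[-> _]|[n [-> _]]]; [lra|].
  left; apply inv_INR_S_pos. }
assert (Hball : forall n x y,
  d x y < / INR (S n) <-> forall j, (j <= n)%nat -> good j x y).
{ intros n x y; destruct (Hd x y) as [[-> H]|[m [-> [Hm Hlt]]]]; simpl in *.
  - split; auto; intros _; apply inv_INR_S_pos.
  - split.
    + intros H j Hj; apply Hlt.
      destruct (Nat.lt_ge_cases j m) as [|Hge]; auto.
      assert (H1 := inv_INR_S_le m n ltac:(lia)); simpl in H1; lra.
    + intros H; assert (Hnm : (n < m)%nat).
      { destruct (Nat.lt_ge_cases n m) as [|Hge]; auto; now destruct Hm; apply H. }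
      apply Rinv_lt_contravar; [|apply (lt_INR (S n) (S m)); lia].
      apply Rmult_lt_0_compat; apply (lt_INR 0 (S _)); lia. }
assert (Hbad : forall n x y, ~ good n x y -> / INR (S n) <= d x y).
{ intros n x y H; apply Rnot_lt_le; rewrite Hball; auto. }
exists d; split; [exact Hpos|]; split; [|split; [|exact Hball]].
- intros x y z; assert (Hxy := Hpos x y); assert (Hyz := Hpos y z).
  destruct (Hd x z) as [[-> _]|[n [-> [Hn _]]]]; [lra|].
  simpl fst in Hn; simpl snd in Hn.
  destruct (classic (good n x y)) as [H1|H1].
  + assert (H2 : ~ good n y z) by eauto.
    apply Hbad in H2; lra.
  + apply Hbad in H1; lra.
- intros x y; split.
  + intros H0 j; apply (proj1 (Hball j x y)); auto.
    rewrite H0; apply inv_INR_S_pos.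
  + intros H; destruct (Hd x y) as [[-> _]|[n [_ [Hn _]]]]; auto.
    now destruct Hn.
Qed.

(** The codes [j] of the conditions on sets of indices: a set [F] satisfies the
    condition [j] when some [k] in [F] has [target ll j k], [0] coding
    nonemptiness and [S (n, m)] the refinement of [n] and [m]. *)
Definition target (ll : nat -> nat -> Prop) (j k : nat) : Prop :=
  match j with
  | O => True
  | S c => ll (fst (of_nat c)) k /\ ll (snd (of_nat c)) k
  end.

(** This compares least witnesses without choosing them; a point with no witness counts as having an
    infinite one. *)
Definition witness_le {X : Type} (U : nat -> X -> Prop) (ll : nat -> nat -> Prop)
    (j : nat) (x y : X) : Prop :=
  forall k, target ll j k -> U k x ->
    exists k', (k' <= k)%nat /\ target ll j k' /\ U k' y.

(** The relation lives on indices, and refinement is asked for two indices at once, so that the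
    indices of the neighbourhoods of a point form a directed family. *)
Definition countable_approx {X : Type} (t : topology X)
    (U : nat -> X -> Prop) (ll : nat -> nat -> Prop) : Prop :=
  is_basis t (fun W => exists n, W = U n) /\
  (forall n k, ll n k -> forall x, U k x -> U n x) /\
  (forall n m x, U n x -> U m x -> exists k, U k x /\ ll n k /\ ll m k) /\
  (forall s : nat -> nat, (forall i, ll (s i) (s (S i))) ->
     exists x, (forall i, U (s i) x) /\
       (forall W, is_open t W -> W x -> exists i, forall y, U (s i) y -> W y)).

Lemma target_pair (ll : nat -> nat -> Prop) (n m k : nat) :
  target ll (S (to_nat (n, m))) k <-> ll n k /\ ll m k.
Proof. unfold target; now rewrite cancel_of_to. Qed.

(** If [k0] is the least witness at [x], it remains a witness throughout the open set [U k0].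
    Finitely many conditions are handled by intersection. *)
Lemma witness_le_open {X : Type} (t : topology X) U ll n x :
  countable_approx t U ll ->
  exists V, is_open t V /\ V x /\
    forall y, V y -> forall j, (j <= n)%nat -> witness_le U ll j x y.
Proof.
intros [[Hop _] _].
assert (H1 : forall j, exists V, is_open t V /\ V x /\
           forall y, V y -> witness_le U ll j x y).
{ intros j; destruct (classic (exists k, target ll j k /\ U k x)) as [H|H].
  - apply least_witness in H; destruct H as [k0 [[Ht Hk] Hmin]].
    exists (U k0); split; [apply Hop; eauto|]; split; [exact Hk|].
    intros y Hy k Htk Hkx; exists k0; auto.
  - exists (fun _ => True); split; [apply open_full|]; split; [exact I|].
    intros y _ k Htk Hkx; exfalso; eauto. }
induction n as [|n [V [HV [Vx Hgood]]]].
- destruct (H1 0%nat) as [V [HV [Vx Hgood]]]; exists V; split; [exact HV|].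
  split; [exact Vx|]; intros y Hy j Hj.
  replace j with 0%nat by lia; auto.
- destruct (H1 (S n)) as [V' [HV' [Vx' Hgood']]].
  exists (fun z => V z /\ V' z); split; [now apply open_inter|].
  split; [auto|]; intros y [Hy Hy'] j Hj.
  destruct (Nat.eq_dec j (S n)) as [->|Hne]; [auto|].
  apply Hgood; [exact Hy|lia].
Qed.

Lemma witness_le_sub {X : Type} (t : topology X) U ll n x y :
  countable_approx t U ll ->
  witness_le U ll (S (to_nat (n, n))) x y -> U n x -> U n y.
Proof.
intros [_ [Hsub [Href _]]] Hw Hx.
destruct (Href n n x Hx Hx) as [k [Hk Hnk]].
destruct (Hw k) as [k' [_ [Ht Hy]]]; [now apply (target_pair ll n n k)|exact Hk|].
apply (target_pair ll n n k') in Ht; now apply (Hsub n k' (proj1 Ht)).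
Qed.

(** A chain inside [F] is built that at stage [i] also refines [i] whenever [i] is in [F]. It is
    thus cofinal in [F], and its limit has exactly the neighbourhoods indexed by [F]. *)
Lemma countable_approx_filter {X : Type} (t : topology X) U ll (F : nat -> Prop) :
  countable_approx t U ll ->
  (forall n m, (forall x, U n x -> U m x) -> F n -> F m) ->
  (exists n, F n) ->
  (forall n m, F n -> F m -> exists k, F k /\ ll n k /\ ll m k) ->
  exists x, forall n, U n x <-> F n.
Proof.
intros [[Hop _] [Hsub [_ Hchain]]] Hup [n0 Hn0] Hdir.
assert (Hnext : forall p : nat * nat, exists k, F (snd p) ->
          F k /\ ll (snd p) k /\ (F (fst p) -> ll (fst p) k)).
{ intros [i c]; simpl.
  (* The default [0] is never reached, since the chain stays in [F]. *)
  destruct (classic (F c)) as [Hc|Hc]; [|exists 0%nat; tauto].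
  destruct (classic (F i)) as [Hi|Hi].
  - destruct (Hdir c i Hc Hi) as [k Hk]; exists k; tauto.
  - destruct (Hdir c c Hc Hc) as [k Hk]; exists k; tauto. }
destruct (functional_choice _ Hnext) as [next Hn]; clear Hnext.
pose (s := fix s i := match i with O => n0 | S i => next (i, s i) end).
assert (HF : forall i, F (s i)).
{ induction i as [|i IH]; [exact Hn0|]; now apply (Hn (i, s i)). }
destruct (Hchain s) as [x [Hx Hnb]].
{ intros i; apply (Hn (i, s i)), HF. }
exists x; intros n; split.
- intros Hnx; destruct (Hnb (U n)) as [i Hi]; [apply Hop; eauto|exact Hnx|].
  now apply (Hup (s i)).
- intros Hn'; apply (Hsub n (s (S n))); [|apply Hx].
  apply (Hn (n, s n)); [apply HF|exact Hn'].
Qed.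

Definition eventually_in {X : Type} (V : X -> Prop) (x : nat -> X) : Prop :=
  exists N, forall p, (N <= p)%nat -> V (x p).

(** Induction on the bound: either the largest candidate occurs late enough to persist by stability,
    or it stops occurring and the bound drops by one. *)
Lemma eventually_in_bounded {X : Type} (Q : nat -> Prop) (U : nat -> X -> Prop)
    (x : nat -> X) (n k : nat) :
  (forall i, exists N, forall m p, (N <= m)%nat -> (m <= p)%nat ->
     U i (x m) -> U i (x p)) ->
  (forall p, (n <= p)%nat -> exists k', (k' <= k)%nat /\ Q k' /\ U k' (x p)) ->
  exists k', (k' <= k)%nat /\ Q k' /\ eventually_in (U k') x.
Proof.
intros Hstable; revert n; induction k as [|k IH]; intros n Hw.
- exists 0%nat; split; [lia|].
  assert (H : forall p, (n <= p)%nat -> Q 0%nat /\ U 0%nat (x p)).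
  { intros p Hp; destruct (Hw p Hp) as [k' [Hk' H]].
    now replace k' with 0%nat in H by lia. }
  split; [now apply (H n)|]; exists n; apply H.
- destruct (Hstable (S k)) as [N HN].
  destruct (classic (exists m, (N <= m)%nat /\ Q (S k) /\ U (S k) (x m)))
    as [[m [Hm [HQ HU]]]|Hnone].
  + exists (S k); split; [lia|]; split; [exact HQ|].
    exists m; intros p Hp; now apply (HN m p).
  + destruct (IH (n + N)%nat) as [k' [Hk' H]].
    * intros p Hp; destruct (Hw p ltac:(lia)) as [k' [Hk' [HQ HU]]].
      exists k'; split; [|auto].
      assert (k' <> S k); [|lia].
      intros ->; apply Hnone; exists p; split; [lia|auto].
    * exists k'; split; [lia|exact H].
Qed.

(** The limit is the point whose basic neighbourhoods are those that eventually contain the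
    sequence; bounded witnesses make this family directed. *)
Lemma witness_le_complete {X : Type} (t : topology X) U ll (x : nat -> X) :
  countable_approx t U ll ->
  (forall j, exists N, forall n p, (N <= n)%nat -> (n <= p)%nat ->
     witness_le U ll j (x n) (x p)) ->
  exists l, forall j, exists N, forall n, (N <= n)%nat ->
    witness_le U ll j (x n) l /\ witness_le U ll j l (x n).
Proof.
intros Happ Hcauchy.
assert (Hstable : forall i, exists N, forall m p, (N <= m)%nat -> (m <= p)%nat ->
          U i (x m) -> U i (x p)).
{ intros i; destruct (Hcauchy (S (to_nat (i, i)))) as [N HN].
  exists N; intros m p Hm Hp; eapply witness_le_sub; eauto. }
assert (Hwit : forall j, exists N, forall n k, (N <= n)%nat ->
   target ll j k -> U k (x n) ->
   exists k', (k' <= k)%nat /\ target ll j k' /\ eventually_in (U k') x).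
{ intros j; destruct (Hcauchy j) as [N HN]; exists N; intros n k Hn Ht Hk.
  apply (eventually_in_bounded _ _ _ n); [exact Hstable|].
  intros p Hp; now apply (HN n p). }
destruct (countable_approx_filter t U ll (fun n => eventually_in (U n) x) Happ)
  as [l Hl].
- intros n m Hnm [N HN]; exists N; auto.
- destruct (Hwit 0%nat) as [N HN].
  destruct Happ as [[_ Hbas] _].
  destruct (Hbas _ (open_full X t) (x N) I) as [W [[k ->] [Hk _]]].
  destruct (HN N k) as [k' [_ [_ H]]]; simpl; eauto.
- intros n m [N1 HN1] [N2 HN2].
  destruct (Hwit (S (to_nat (n, m)))) as [N HN].
  destruct Happ as [_ [_ [Href _]]].
  set (p := (N + N1 + N2)%nat).
  destruct (Href n m (x p)) as [k [Hk Hll]];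
    [apply HN1; lia|apply HN2; lia|].
  destruct (HN p k) as [k' [_ [Ht H]]];
    [lia|now apply (target_pair ll n m k)|exact Hk|].
  apply (target_pair ll n m k') in Ht; eauto.
- exists l; intros j; destruct (Hwit j) as [N HN].
  (* The least witness at [l] indexes a neighbourhood of [l], so it is eventually a witness at
     [x n]. *)
  assert (Hback : exists N', forall n, (N' <= n)%nat -> witness_le U ll j l (x n)).
  { destruct (classic (exists k, target ll j k /\ U k l)) as [H|H].
    - apply least_witness in H; destruct H as [k0 [[Ht Hk] Hmin]].
      apply Hl in Hk; destruct Hk as [N' HN'].
      exists N'; intros n Hn k Htk Hkl; exists k0; auto.
    - exists 0%nat; intros n _ k Htk Hkl; exfalso; eauto. }
  destruct Hback as [N' HN'].
  exists (N + N')%nat; intros n Hn; split; [|apply HN'; lia].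
  intros k Ht Hk; destruct (HN n k) as [k' [Hle [Ht' H]]]; [lia|auto|auto|].
  exists k'; split; [exact Hle|]; split; [exact Ht'|]; now apply Hl.
Qed.

Lemma countable_approx_quasi_polish {X : Type} (t : topology X) U ll :
  T0 t -> countable_approx t U ll -> quasi_polish t.
Proof.
intros HT0 Happ; assert (Hbasis := proj1 Happ).
destruct (preorders_quasi_metric (witness_le U ll)) as [d [Hpos [Htri [Hzero Hball]]]].
{ intros j x k Ht Hk; exists k; auto. }
{ intros j x y z Hxy Hyz k Ht Hk.
  destruct (Hxy k Ht Hk) as [k1 [H1 [Ht1 Hk1]]].
  destruct (Hyz k1 Ht1 Hk1) as [k2 [H2 H]]; exists k2; split; [lia|exact H]. }
split; [now exists U|]; exists d; split; [|split].
- split; [exact Hpos|]; split; [|exact Htri].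
  intros x y; split.
  + intros ->; assert (H : d y y = 0); [|auto].
    apply Hzero; intros j k Ht Hk; exists k; auto.
  + assert (Hsub : forall u v, d u v = 0 -> forall W, is_open t W -> W u -> W v).
    { intros u v Huv W HW Wu.
      destruct (proj2 Hbasis W HW u Wu) as [W' [[n ->] [Hn HnW]]].
      apply HnW; eapply witness_le_sub; eauto; now apply Hzero. }
    intros [Hxy Hyx]; apply HT0; intros W HW; split; eapply Hsub; eauto.
- intros W; split.
  + intros HW x Wx.
    destruct (proj2 Hbasis W HW x Wx) as [W' [[n ->] [Hn HnW]]].
    (* Within this radius condition [S (to_nat (n, n))] holds, which preserves membership in
       [U n]. *)
    exists (/ INR (S (S (to_nat (n, n))))); split; [apply inv_INR_S_pos|].
    intros y Hy; apply HnW; eapply witness_le_sub; eauto.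
    now apply (proj1 (Hball _ x y) Hy).
  + intros HW; apply open_of_nbhds; intros x Wx.
    destruct (HW x Wx) as [r [Hr Hrball]].
    destruct (inv_INR_S_small r Hr) as [n Hn].
    destruct (witness_le_open t U ll n x Happ) as [V [HV [Vx Hgood]]].
    exists V; split; [exact HV|]; split; [exact Vx|].
    intros y Hy; apply Hrball; eapply Rlt_trans; [|exact Hn].
    apply Hball; auto.
- intros x Hcauchy.
  destruct (witness_le_complete t U ll x Happ) as [l Hl].
  (* [qm_cauchy] gives a weak inequality and [Hball] needs a strict one, hence the next smaller
     reciprocal. *)
  { intros j; destruct (Hcauchy (/ INR (S (S j))) (inv_INR_S_pos _)) as [N HN].
    exists N; intros n p Hn Hp; apply (proj1 (Hball j (x n) (x p))); [|lia].
    eapply Rle_lt_trans; [apply HN; auto|].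
    apply Rinv_lt_contravar; [|apply (lt_INR (S j) (S (S j))); lia].
    apply Rmult_lt_0_compat; apply (lt_INR 0 (S _)); lia. }
  exists l; intros eps Heps.
  destruct (inv_INR_S_small eps Heps) as [n Hn].
  assert (Huniform : exists N, forall p, (N <= p)%nat -> forall j, (j <= n)%nat ->
            witness_le U ll j (x p) l /\ witness_le U ll j l (x p)).
  { clear Hn; induction n as [|n [N HN]].
    - destruct (Hl 0%nat) as [N HN]; exists N; intros p Hp j Hj.
      replace j with 0%nat by lia; auto.
    - destruct (Hl (S n)) as [N' HN']; exists (N + N')%nat; intros p Hp j Hj.
      destruct (Nat.eq_dec j (S n)) as [->|Hne]; [apply HN'; lia|].
      apply HN; lia. }
  destruct Huniform as [N HN]; exists N; intros p Hp.
  eapply Rlt_trans; [|exact Hn].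
  apply Rmax_lub_lt; apply Hball; intros j Hj; now apply HN.
Qed.

(** Approximation is only tested through a countable basis: for each pair of
    basic sets [b m] and [b l] one keeps a single [V] in [B] approximating some
    subset of [b m] and containing [b l].  Pairs without such a [V] get the
    empty set, which need not belong to [B]. *)
Lemma conv_approx_countable {X : Type} (t : topology X) :
  conv_approx_space t -> has_countable_basis t ->
  exists U ll, countable_approx t U ll.
Proof.
intros [B [ll [[HBop HBbas] [Hsub [Hmono [Href Hchain]]]]]] [b [Hbop Hbbas]].
pose (P := fun (c : nat) (V : X -> Prop) => B V /\
  (forall x, b (snd (of_nat c)) x -> V x) /\
  exists T, B T /\ (forall x, T x -> b (fst (of_nat c)) x) /\ ll T V).
assert (Hex : forall c, exists V, P c V \/
          ((forall V', ~ P c V') /\ forall x, ~ V x)).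
{ intros c; destruct (classic (exists V, P c V)) as [[V HV]|H].
  - exists V; auto.
  - exists (fun _ => False); right; split; [intros V' HV'; eauto|auto]. }
destruct (functional_choice _ Hex) as [U HU]; clear Hex.
assert (HUP : forall n x, U n x -> P n (U n)).
{ intros n x Hx; destruct (HU n) as [H|[_ H]]; [exact H|now destruct (H x)]. }
assert (Hfind : forall W x, is_open t W -> W x -> exists c, U c x /\
   (forall y, U c y -> W y) /\
   forall T, B T -> (forall y, W y -> T y) -> ll T (U c)).
{ intros W x HW Wx.
  destruct (Hbbas W HW x Wx) as [W1 [[m ->] [Hm HmW]]].
  (* The sets [T] and [V] show that the pair [(m, l)] has an admissible choice; the set actually
     chosen may differ from [V]. *)
  destruct (HBbas (b m) ltac:(apply Hbop; eauto) x Hm) as [T [HT [Tx HTm]]].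
  destruct (Href T HT x Tx) as [V [HV [Vx HTV]]].
  destruct (Hbbas V (HBop V HV) x Vx) as [W2 [[l ->] [Hl HlV]]].
  exists (to_nat (m, l)).
  destruct (HU (to_nat (m, l))) as [HP|[HP _]].
  - unfold P in HP; rewrite cancel_of_to in HP; simpl in HP.
    destruct HP as [HUB [HlU [T' [HT' [HT'm HT'U]]]]].
    split; [auto|]; split.
    + intros y Hy; apply HmW, HT'm; now apply (Hsub T' _ HT' HUB HT'U).
    + intros S HS HWS; apply (Hmono T' _ S); auto.
  - destruct (HP V); unfold P; rewrite cancel_of_to; simpl.
    split; [exact HV|]; split; [exact HlV|]; eauto. }
assert (HUop : forall n, is_open t (U n)).
{ intros n; apply open_of_nbhds; intros x Hx; exists (U n).
  destruct (HUP n x Hx) as [HB _]; auto. }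
(* Membership in [B] is built into the relation to exclude empty placeholders outside [B]. *)
exists U, (fun n k => B (U n) /\ B (U k) /\ ll (U n) (U k)).
split; [|split; [|split]].
- split; [intros W [n ->]; auto|].
  intros W HW x Wx; destruct (Hfind W x HW Wx) as [c [Hc [HcW _]]].
  exists (U c); split; [eauto|auto].
- intros n k [Hn [Hk Hnk]]; now apply Hsub.
- intros n m x Hn Hm.
  (* A neighbourhood found inside the intersection is approximated by both sets, by monotonicity. *)
  destruct (Hfind (fun y => U n y /\ U m y) x) as [k [Hk [_ Hll]]];
    [apply open_inter; auto|auto|].
  destruct (HUP n x Hn) as [Bn _], (HUP m x Hm) as [Bm _], (HUP k x Hk) as [Bk _].
  exists k; split; [exact Hk|]; split; (split; [|split]); auto;
    apply Hll; tauto.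
- intros s Hs; apply (Hchain (fun i => U (s i))); apply Hs.
Qed.

Theorem theorem3p11 (X : Type) (t : topology X) :
  quasi_polish t <-> (T0 t /\ conv_approx_space t /\ has_countable_basis t).
Proof.
split.
- intros Hqp; split; [|split].
  + destruct Hqp as [_ [d [Hd [Hind _]]]]; now apply (quasi_metric_T0 t d).
  + now apply quasi_polish_conv_approx.
  + apply Hqp.
- intros [HT0 [Happ Hb]].
  destruct (conv_approx_countable t Happ Hb) as [U [ll Hll]].
  now apply (countable_approx_quasi_polish t U ll).
Qed.
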